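(* Let $Y$ be the limiting quicksort distribution and $f(t)=\mathbb{E}e^{itY}$ its characteristic function. There is a constant $\eta>0$ such that $f(t)=O(e^{-\eta|t|})$ as $|t|\to\infty$.
   Context: For $n\ge 1$ let $X_n$ be the number of steps (comparisons) used by the Quicksort algorithm to sort the list $\sigma(1),\dots,\sigma(n)$, where $\sigma$ is a permutation chosen uniformly at random from the symmetric group $S_n$. Then $(X_n-\mathbb{E}X_n)/n$ converges in distribution to a random variable $Y$, the limiting quicksort distribution. *)

(* Defs.v *)
From HB Require Import structures.
From mathcomp Require Import all_boot all_order all_algebra all_fingroup.
From mathcomp Require Import complex.
From mathcomp Require Import all_classical all_reals all_analysis.

Set Implicit Arguments.
Unset Strict Implicit.
Unset Printing Implicit Defensive.

Import Order.TTheory GRing.Theory Num.Theory.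
Import numFieldNormedType.Exports.

Local Open Scope classical_set_scope.
Local Open Scope ring_scope.

(* Each function below returns its result paired with the number of
    comparisons [x < p] it has evaluated. *)

Fixpoint qs_split (p : nat) (s : seq nat) : (seq nat * seq nat) * nat :=
  if s is x :: s' then
    let: ((lo, hi), c) := qs_split p s' in
    if (x < p)%N then ((x :: lo, hi), c.+1) else ((lo, x :: hi), c.+1)
  else (([::], [::]), 0%N).

(* The recursion is on the fuel [k]; [k = size s] is enough, see
   [quicksort_cons]. *)
Fixpoint quicksort_rec (k : nat) (s : seq nat) : seq nat * nat :=
  match k, s with
  | k'.+1, p :: s' =>
      let: ((lo, hi), c) := qs_split p s' in
      let: (lo', cl) := quicksort_rec k' lo in
      let: (hi', ch) := quicksort_rec k' hi in
      (lo' ++ p :: hi', (c + cl + ch)%N)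
  | _, _ => ([::], 0%N)
  end.

Definition quicksort (s : seq nat) : seq nat * nat := quicksort_rec (size s) s.

Lemma qs_splitE p s :
  qs_split p s = (([seq x <- s | (x < p)%N], [seq x <- s | (p <= x)%N]), size s).
Proof.
by elim: s => //= x s ->; case: (ltnP x p).
Qed.

Lemma quicksort_recE k s : (size s <= k)%N -> quicksort_rec k s = quicksort s.
Proof.
rewrite /quicksort; elim: k {-2}k (leqnn k) s => [|m IH] [|k] // km [|p s] // sk.
rewrite /= qs_splitE.
have sl (a : pred nat) : (size (seq.filter a s) <= size s)%N.
  by rewrite size_filter count_size.
have sm : (size s <= m)%N by exact: leq_trans (sk : size s <= k)%N km.
have E a : quicksort_rec k (seq.filter a s) =
           quicksort_rec (size s) (seq.filter a s).
  rewrite (IH k) //; last exact: leq_trans (sl _) sk.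
  by rewrite (IH (size s)).
by rewrite !E.
Qed.

Lemma quicksort_cons p s :
  let lo := [seq x <- s | (x < p)%N] in
  let hi := [seq x <- s | (p <= x)%N] in
  quicksort (p :: s) =
  ((quicksort lo).1 ++ p :: (quicksort hi).1,
   (size s + (quicksort lo).2 + (quicksort hi).2)%N).
Proof.
rewrite /quicksort /= qs_splitE !quicksort_recE ?size_filter ?count_size //.
by rewrite /quicksort !size_filter; do 2 case: quicksort_rec.
Qed.

Lemma quicksort_sorts s : (quicksort s).1 = sort leq s.
Proof.
elim: {s}_.+1 {-2}s (ltnSn (size s)) => // m IH [|p s] // sm.
have sl (a : pred nat) : (size (seq.filter a s) < m)%N.
  by rewrite size_filter (leq_ltn_trans (count_size _ _)).
rewrite quicksort_cons /= !IH //.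
apply: (sorted_eq leq_trans anti_leq); last 1 first.
- rewrite perm_sym perm_sort perm_sym perm_catC /= perm_cons.
  apply: (@perm_trans _ ([seq x <- s | (p <= x)%N] ++ [seq x <- s | (x < p)%N])).
    by apply: perm_cat; rewrite perm_sort.
  rewrite perm_sym -(perm_filterC (fun x => p <= x)%N s).
  by under [X in _ ++ X]eq_filter => x do rewrite /= -ltnNge.
- rewrite sorted_pairwise; last exact: leq_trans.
  rewrite -cat1s pairwise_cat pairwise_cat allrel1l -!sorted_pairwise;
    try exact: leq_trans.
  rewrite !(sort_sorted leq_total) /= andbT; apply/andP; split.
    apply/allrelP => x y; rewrite mem_sort mem_filter inE mem_sort mem_filter.
    move=> /andP[xp _] /orP[/eqP ->|/andP[py _]]; first exact: ltnW.
    exact: leq_trans (ltnW xp) py.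
  by apply/allP => y; rewrite mem_sort mem_filter => /andP[].
- exact: (sort_sorted leq_total).
Qed.

(* The instances are attached to [perm_type], of which ['S_n] is an unfoldable
   alias: attached to ['S_n] they would not be found by inference. *)

HB.instance Definition _ (I : finType) := isPointed.Build (perm_type I) 1%g.
HB.instance Definition _ (I : finType) := @isMeasurable.Build
  default_measure_display (perm_type I) discrete_measurable
  discrete_measurable0 discrete_measurableC discrete_measurableU.

Definition unif_perm (R : realType) (n : nat) (A : set 'S_n) : \bar R :=
  (#|[pred s : 'S_n | s \in A]|%:R / (n`!)%:R)%:E.

Section unif_perm.
Context (R : realType) (n : nat).
Local Open Scope ereal_scope.

Let m : {measure set 'S_n -> \bar R} :=
  mscale ((n`!)%:R^-1 : R)%:nng%R
    (msum (fun k => \d_(nth (1%g : 'S_n) (enum {: 'S_n}) k)) #|{: 'S_n}|).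

Lemma unif_permE (A : set 'S_n) : unif_perm R A = m A.
Proof.
rewrite /m /= /mscale /= /msum muleC /unif_perm EFinM; congr (_ * _).
rewrite -sum1_card natr_sum -sumEFin big_mkcond /=.
rewrite -(big_mkord xpredT (fun k => \d_(nth (1%g : 'S_n) (enum {: 'S_n}) k) A)).
rewrite cardE -(big_nth _ xpredT (fun s => \d_s A)) big_enum /=.
by apply: eq_bigr => s _; rewrite diracE inE; case: (s \in A).
Qed.

Let unif_perm0 : unif_perm R (set0 : set 'S_n) = 0.
Proof. by rewrite unif_permE measure0. Qed.

Let unif_perm_ge0 (A : set 'S_n) : 0 <= unif_perm R A.
Proof. by rewrite unif_permE. Qed.

Let unif_perm_sigma_additive : semi_sigma_additive (@unif_perm R n).
Proof.
have -> : @unif_perm R n = m by apply/funext => A; exact: unif_permE.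
exact: measure_semi_sigma_additive.
Qed.

HB.instance Definition _ := isMeasure.Build _ _ _ (@unif_perm R n)
  unif_perm0 unif_perm_ge0 unif_perm_sigma_additive.

Let unif_permT : unif_perm R [set: 'S_n] = 1.
Proof.
rewrite /unif_perm (eq_card (B := {: 'S_n})); last by move=> s; rewrite !inE in_setT.
by rewrite card_Sn divff // pnatr_eq0 -lt0n fact_gt0.
Qed.

HB.instance Definition _ := Measure_isProbability.Build _ _ _
  (@unif_perm R n) unif_permT.

End unif_perm.

(* [sigma] acts on [{0, .., n-1}], hence the successors in the list
    [sigma(1), .., sigma(n)]. *)
Definition perm_list (n : nat) (sigma : 'S_n) : seq nat :=
  [seq (val (sigma i)).+1 | i <- enum 'I_n].

Definition quicksort_steps (R : realType) (n : nat) (sigma : 'S_n) : R :=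
  (quicksort (perm_list sigma)).2%:R.

(* At [n = 0] this is [0 / 0 = 0], which does not affect the limit. *)
Definition quicksort_normalized (R : realType) (n : nat) (sigma : 'S_n) : R :=
  (quicksort_steps R sigma - fine 'E_(@unif_perm R n)[@quicksort_steps R n])
  / n%:R.

HB.instance Definition _ (R : realType) (n : nat) :=
  @isMeasurableFun.Build _ _ 'S_n R (@quicksort_normalized R n)
    (fun _ _ _ => I).

(* The [n]-th variable lives on its own probability space. *)
Definition cvg_in_distribution (R : realType)
    (d : nat -> measure_display) (T : forall n, measurableType (d n))
    (P : forall n, probability (T n) R) (X : forall n, {RV (P n) >-> R})
    (d' : measure_display) (T' : measurableType d') (Q : probability T' R)
    (Y : {RV Q >-> R}) : Prop :=
  forall g : R -> R, continuous g -> (exists M : R, forall x, `|g x| <= M) ->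
    ('E_(P n)[g \o X n] @[n --> \oo] --> 'E_Q[g \o Y])%E.

Definition quicksort_limit (R : realType) (d : measure_display)
    (T : measurableType d) (P : probability T R) (Y : {RV P >-> R}) : Prop :=
  cvg_in_distribution (P := fun n => @unif_perm R n)
    (fun n => @quicksort_normalized R n) Y.

Local Open Scope complex_scope.

(* [e^{ix}]: the library has no complex exponential. *)
Definition expi (R : realType) (x : R) : R[i] := cos x +i* sin x.

Definition complex_expectation (R : realType) (d : measure_display)
    (T : measurableType d) (P : probability T R) (Z : T -> R[i]) : R[i] :=
  fine 'E_P[fun w => complex.Re (Z w)] +i* fine 'E_P[fun w => complex.Im (Z w)].

Definition char_fun (R : realType) (d : measure_display)
    (T : measurableType d) (P : probability T R) (Y : {RV P >-> R})
    (t : R) : R[i] :=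
  complex_expectation P (fun w => expi (t * Y w)).

(* [f(t) = O(g(t))] as [|t| -> oo], for complex-valued [f] and real-valued
    [g]; [Normc.normc] is the complex modulus with values in [R]. *)
Definition bigO_abs_infty (R : realType) (f : R -> R[i]) (g : R -> R) : Prop :=
  exists C M : R, forall t, M <= `|t| -> Normc.normc (f t) <= C * `|g t|.

(* Main.v *)
Require Import Defs.
From HB Require Import structures.
From mathcomp Require Import all_boot all_order all_algebra all_fingroup.
From mathcomp Require Import complex.
From mathcomp Require Import all_classical all_reals all_analysis.
From mathcomp Require Import measurable_realfun ring lra zify.

Set Implicit Arguments.
Unset Strict Implicit.
Unset Printing Implicit Defensive.

Import Order.TTheory GRing.Theory Num.Theory.
Import numFieldNormedType.Exports.

Local Open Scope ring_scope.

(* Let [f] be the characteristic function of [Y] and [k = |f|]. The recursion of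
   Quicksort gives, in the limit, [t k(t) <= int_0^t k(x) k(t - x) dx], of which
   every [e^{-eta t}] is an exact solution; so once [m(x) = e^{eta x} k(x)] is at
   most [1] on some [[1/4, t]], the (strictly negative) mean of [m - 1] over
   [[0, 1/2]] keeps [m(t) < 1], and [m <= 1] propagates to all larger [t].
   To start, one needs only [k < 1] on [[1/4, 1]]: the toll tends to [1] when the
   pivot is extreme, so [f(t)] is a mean of numbers of modulus at most [1] of
   which a fixed proportion is close to [e^{it} f(t)], which differs from [f(t)].
   Integrals are avoided by working with the finite-[n] averages throughout. *)

(** * Sums over the permutations of a list: first entry and shuffles *)

Lemma big_permutations (T : eqType) (S : nmodType) (F : seq T -> S) (s : seq T) :
  uniq s -> (0 < size s)%N ->
  \sum_(p <- permutations s) F p =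
  \sum_(x <- s) \sum_(q <- permutations (rem x s)) F (x :: q).
Proof.
move=> us s0; rewrite (perm_big _ (permutationsE s0)) undup_id //.
by rewrite big_allpairs_dep.
Qed.

Lemma filter_rem (T : eqType) (a : pred T) (x : T) (s : seq T) : uniq s ->
  [seq y <- rem x s | a y] = rem x [seq y <- s | a y].
Proof.
move=> us; rewrite !rem_filter ?filter_uniq // -!filter_predI.
by apply: eq_filter => y /=; rewrite andbC.
Qed.

(* Shuffles: a permutation of [r] is determined by its two restrictions, to the
   elements satisfying [a] and to the others, and by the positions of the
   former. *)
Lemma sum_permutations_filter (T : eqType) (S : comNzRingType) (a : pred T)
    (A B : seq T -> S) (r : seq T) : uniq r ->
  \sum_(q <- permutations r) A [seq y <- q | a y] * B [seq y <- q | ~~ a y] =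
  'C(size r, count a r)%:R *
  ((\sum_(u <- permutations [seq y <- r | a y]) A u) *
   (\sum_(v <- permutations [seq y <- r | ~~ a y]) B v)).
Proof.
elim: {r}(size r) {-2}r (erefl (size r)) A B => [|n IH] r sr A B ur.
  by move/size0nil: sr => ->; rewrite /= !big_seq1 /= bin0 mul1r.
rewrite big_permutations ?sr // (bigID a) /=.
set SA := \sum_(u <- _) A u; set SB := \sum_(v <- _) B v.
have sn x : x \in r -> size (rem x r) = n by move=> xr; rewrite size_rem // sr.
have -> : \sum_(x <- r | a x) \sum_(q <- permutations (rem x r))
    A [seq y <- x :: q | a y] * B [seq y <- x :: q | ~~ a y] =
    (if count a r is c.+1 then 'C(n, c)%:R else 0) * (SA * SB).
  case c : (count a r) => [|k].
    rewrite mul0r big_seq_cond big1 // => x /andP[xr ax].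
    by move/eqP: c; rewrite -leqn0 leqNgt -has_count => /hasP[]; exists x.
  rewrite /SA (@big_permutations _ _ A) ?filter_uniq ?size_filter ?c //.
  rewrite mulr_suml mulr_sumr -[LHS]big_filter; apply: eq_big_seq => x.
  rewrite mem_filter => /andP[ax xr] /=; rewrite ax /=.
  rewrite (IH _ (sn _ xr) (fun u => A (x :: u))) ?rem_uniq // sn //.
  have -> : count a (rem x r) = k.
    by move/seq.permP: (perm_to_rem xr) => /(_ a); rewrite c /= ax => -[].
  rewrite !filter_rem //; congr (_ * (_ * _)).
  by rewrite [X in permutations X]rem_id ?mem_filter ?ax.
have -> : \sum_(x <- r | ~~ a x) \sum_(q <- permutations (rem x r))
    A [seq y <- x :: q | a y] * B [seq y <- x :: q | ~~ a y] =
    'C(n, count a r)%:R * (SA * SB).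
  have sC := count_predC a r; rewrite sr in sC.
  case c : (count (predC a) r) sC => [|k] sC.
    rewrite addn0 in sC; rewrite sC bin_small // mul0r big_seq_cond big1 //.
    move=> x /andP[xr ax].
    by move/eqP: c; rewrite -leqn0 leqNgt -has_count => /hasP[]; exists x.
  rewrite /SB (@big_permutations _ _ B) ?filter_uniq ?size_filter ?c //.
  rewrite mulr_sumr mulr_sumr -[LHS]big_filter; apply: eq_big_seq => x.
  rewrite mem_filter => /andP[ax xr] /=; rewrite (negbTE ax) /=.
  rewrite (IH _ (sn _ xr) A (fun u => B (x :: u))) ?rem_uniq // sn //.
  have -> : count a (rem x r) = count a r.
    by move/seq.permP: (perm_to_rem xr) => /(_ a); rewrite /= (negbTE ax).
  rewrite !filter_rem //; congr (_ * (_ * _)).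
  by rewrite [X in permutations X]rem_id ?mem_filter ?(negbTE ax).
rewrite -mulrDl; congr (_ * _).
by case: (count a r) => [|c]; rewrite ?bin0 ?add0r // binS natrD addrC.
Qed.

(** In the sorted list the entry at index [i] has exactly [i] smaller ones; hence the rank of a
    uniformly chosen pivot is uniform. *)
Lemma sum_count_ltn (S : nmodType) (F : nat -> S) (s : seq nat) : uniq s ->
  \sum_(x <- s) F (count (ltn^~ x) s) = \sum_(j < size s) F j.
Proof.
move=> us; have ps : perm_eq s (sort leq s) by rewrite perm_sym perm_sort.
rewrite (perm_big _ ps) (perm_size ps) (big_nth 0%N) big_mkord.
apply: eq_bigr => i _; congr F; rewrite (seq.permP ps).
have st : sorted ltn (sort leq s).
  by rewrite ltn_sorted_uniq_leq sort_uniq us (sort_sorted leq_total).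
exact: count_lt_nth st (ltn_ord i).
Qed.

(** * The probability generating function of the number of comparisons *)

Section quicksort_pgf.
Context (R : numFieldType).

(** As a polynomial it serves twice: its derivative at [1] is the mean, and its value at [expi s] is
    the characteristic function of the number of comparisons. *)
Definition quicksort_pgf (n : nat) : {poly R} :=
  (n`!%:R^-1)%:P * \sum_(p <- permutations (iota 1 n)) 'X ^+ (quicksort p).2.

Let G (s : seq nat) : {poly R} :=
  \sum_(p <- permutations s) 'X ^+ (quicksort p).2.

(** The first entry [x] is the pivot and costs [n] comparisons; by [sum_permutations_filter] the two
    sublists are then independent and uniform, so their sums multiply. *)
Let G_rec n (s : seq nat) : uniq s -> size s = n.+1 ->
  G s = \sum_(x <- s) 'X^n * ('C(n, count (ltn^~ x) s)%:R *
    (G [seq y <- rem x s | (y < x)%N] * G [seq y <- rem x s | ~~ (y < x)%N])).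
Proof.
move=> us sn; rewrite /G big_permutations ?sn //.
apply: eq_big_seq => x xs.
have sr : size (rem x s) = n by rewrite size_rem // sn.
have <- : count (ltn^~ x) (rem x s) = count (ltn^~ x) s.
  by move/seq.permP: (perm_to_rem xs) => /(_ (ltn^~ x)); rewrite /= ltnn.
rewrite -sr -sum_permutations_filter ?rem_uniq // mulr_sumr.
apply: eq_big_seq => q; rewrite mem_permutations => /perm_size sq.
rewrite quicksort_cons /= sq !exprD -mulrA; congr (_ * (_ * 'X ^+ (quicksort _).2)).
by apply: eq_filter => y; rewrite leqNgt.
Qed.

(** That [G] depends only on the length is assumed here for lengths at most [n], which is what the
    strong induction of [G_iota] provides. *)
Let G_rec_iota n (s : seq nat) : uniq s -> size s = n.+1 ->
  (forall k t, (k <= n)%N -> uniq t -> size t = k -> G t = G (iota 1 k)) ->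
  G s = \sum_(j < n.+1) 'X^n *
    ('C(n, j)%:R * (G (iota 1 j) * G (iota 1 (n - j)))).
Proof.
move=> us sn IH; rewrite (G_rec us sn) -sn -(sum_count_ltn (fun j => 'X^n *
  ('C(n, j)%:R * (G (iota 1 j) * G (iota 1 (n - j))))) us).
apply: eq_big_seq => x xs.
have sr : size (rem x s) = n by rewrite size_rem // sn.
have e : count (ltn^~ x) (rem x s) = count (ltn^~ x) s.
  by move/seq.permP: (perm_to_rem xs) => /(_ (ltn^~ x)); rewrite /= ltnn.
have e' : (count (predC (ltn^~ x)) (rem x s) = n - count (ltn^~ x) s)%N.
  by rewrite -e -sr -(count_predC (ltn^~ x) (rem x s)) addKn.
congr (_ * (_ * (_ * _))); apply: IH; rewrite ?filter_uniq ?rem_uniq //.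
- by rewrite -e -sr count_size.
- by rewrite size_filter e.
- by rewrite leq_subr.
- by rewrite size_filter e'.
Qed.

Let G_iota n (s : seq nat) : uniq s -> size s = n -> G s = G (iota 1 n).
Proof.
elim/ltn_ind: n s => -[|n] IH s us sn; first by rewrite (size0nil sn).
by rewrite !(@G_rec_iota n) ?iota_uniq ?size_iota // => k t kn; apply: IH.
Qed.

Lemma quicksort_pgf0 : quicksort_pgf 0 = 1.
Proof. by rewrite /quicksort_pgf /= big_seq1 fact0 invr1 mul1r. Qed.

Lemma quicksort_pgfS n : quicksort_pgf n.+1 =
  (n.+1%:R^-1)%:P * ('X^n *
    \sum_(j < n.+1) quicksort_pgf j * quicksort_pgf (n - j)).
Proof.
rewrite {1}/quicksort_pgf -/(G _) (@G_rec_iota n) ?iota_uniq ?size_iota //;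
  last by move=> k t _; apply: G_iota.
rewrite !mulr_sumr; apply: eq_bigr => j _.
rewrite /quicksort_pgf -!/(G _).
have jn : (j <= n)%N by rewrite -ltnS.
have -> : (n.+1`!%:R^-1 : R)%:P =
  (n.+1%:R^-1)%:P * (n`!%:R^-1)%:P :> {poly R}.
  by rewrite -polyCM factS natrM invfM.
(* The factorials of [j] and [n - j] become the normalizations of the two smaller generating
   functions, and that of [n] cancels. *)
have -> : ('C(n, j)%:R : {poly R}) = (n`!%:R)%:P * (j`!%:R^-1)%:P * ((n - j)`!%:R^-1)%:P.
  rewrite -(bin_fact jn) !natrM -!polyCM -polyC_natr; congr _%:P.
  have f0 k : (k`!%:R : R) != 0 by rewrite pnatr_eq0 -lt0n fact_gt0.
  by rewrite -mulrA -invfM mulfK // mulf_neq0.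
have e : (n`!%:R^-1)%:P * (n`!%:R)%:P = 1 :> {poly R}.
  by rewrite -polyCM mulVf // pnatr_eq0 -lt0n fact_gt0.
rewrite -[RHS]mul1r -e; ring.
Qed.

End quicksort_pgf.

(** * The mean number of comparisons and the toll *)

Section quicksort_mean.
Context (R : realType).
Local Notation pgf := (@quicksort_pgf R).

Lemma quicksort_pgf_at1 n : (pgf n).[1] = 1.
Proof.
elim/ltn_ind: n => -[|n] IH; first by rewrite quicksort_pgf0 hornerC.
rewrite quicksort_pgfS hornerM hornerC hornerM hornerXn expr1n mul1r horner_sum.
rewrite (eq_bigr (fun=> 1)) => [|j _]; last first.
  by rewrite hornerM !IH ?mulr1 // ltnS leq_subr.
by rewrite sumr_const card_ord mulVf // pnatr_eq0.
Qed.

Definition quicksort_mean (n : nat) : R := (pgf n)^`().[1].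

(** This is the product rule at [1], where all the generating functions equal [1]; the two sums it
    yields are exchanged by reversing [j] into [n - j]. *)
Lemma quicksort_meanS n : quicksort_mean n.+1 =
  n%:R + n.+1%:R^-1 * ((\sum_(j < n.+1) quicksort_mean j) *+ 2).
Proof.
rewrite /quicksort_mean quicksort_pgfS derivM derivC mul0r add0r derivM derivXn.
rewrite hornerM hornerC hornerD !hornerM hornerMn !hornerXn !expr1n !mul1r !horner_sum.
rewrite (eq_bigr (fun=> 1)) => [|j _]; last first.
  by rewrite hornerM !quicksort_pgf_at1 mulr1.
rewrite sumr_const card_ord mulrDr mulrCA mulVf ?pnatr_eq0 // mulr1.
congr (_ + _ * _); rewrite raddf_sum horner_sum.
rewrite (eq_bigr (fun j : 'I_n.+1 => (pgf j)^`().[1] + (pgf (n - j))^`().[1])); last first.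
  move=> j _; rewrite /= derivM hornerD (hornerM _ (pgf (n - j))) (hornerM (pgf j)).
  by rewrite !quicksort_pgf_at1 mulr1 mul1r.
rewrite big_split /= mulr2n; congr (_ + _).
by rewrite (reindex_inj rev_ord_inj) /=; apply: eq_bigr => j _; rewrite subSS subKn // -ltnS.
Qed.

Definition harmonic_sum (n : nat) : R := \sum_(i < n) i.+1%:R^-1.

Lemma harmonic_sumS n : harmonic_sum n.+1 = harmonic_sum n + n.+1%:R^-1.
Proof. by rewrite /harmonic_sum big_ord_recr. Qed.

Lemma quicksort_meanE n :
  quicksort_mean n = (n.+1%:R * harmonic_sum n) *+ 2 - 4 * n%:R.
Proof.
(* The closed form is assumed only below [m], so that this summation can be used inside the strong
   induction on [n]. *)
have key m : (forall k, (k < m)%N ->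
    quicksort_mean k = (k.+1%:R * harmonic_sum k) *+ 2 - 4 * k%:R) ->
    \sum_(j < m) quicksort_mean j =
    m%:R * m.+1%:R * harmonic_sum m - 2 * m%:R ^+ 2 - m%:R * (m%:R - 1) / 2.
  elim: m => [|m IH] H; first by rewrite big_ord0 /harmonic_sum big_ord0; lra.
  rewrite big_ord_recr /= IH => [|k km]; last by apply: H; exact: ltnW.
  rewrite H // harmonic_sumS -!natr1.
  by field; rewrite natr1 pnatr_eq0.
elim/ltn_ind: n => -[|n] IH.
  by rewrite /quicksort_mean quicksort_pgf0 derivC hornerC /harmonic_sum big_ord0; lra.
rewrite quicksort_meanS key // -!natr1.
by field; rewrite natr1 pnatr_eq0.
Qed.

(** The mean cost of sorting [n.+1] entries given that the pivot exceeds exactly [j] of them, minus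
    the unconditional mean. Divided by [n.+1], with [j / n] close to [u], it approximates the
    classical [C(u) = 1 + 2 u ln u + 2 (1 - u) ln (1 - u)]. *)
Definition quicksort_toll (n j : nat) : R :=
  n%:R + quicksort_mean j + quicksort_mean (n - j) - quicksort_mean n.+1.

Lemma harmonic_sumB_le a b : harmonic_sum (a + b) - harmonic_sum a <= b%:R / a.+1%:R.
Proof.
elim: b => [|b IH]; first by rewrite addn0 subrr mul0r.
rewrite addnS harmonic_sumS -[b.+1]addn1 natrD mulrDl addrAC lerD // mul1r.
by rewrite lef_pV2 ?posrE ?ltr0n // ler_nat ltnS leq_addr.
Qed.

Lemma harmonic_sum_mono a b : (a <= b)%N -> harmonic_sum a <= harmonic_sum b.
Proof.
move=> /subnKC <-; elim: (b - a)%N => [|k IH]; first by rewrite addn0.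
by rewrite addnS harmonic_sumS ler_wpDr // invr_ge0.
Qed.

(* The toll is within [9/E] of [n + 1] when the pivot has rank below a
   proportion [1/E^2]: this replaces the limit [C(u) -> 1] as [u -> 0]. *)
Lemma quicksort_toll_near (E m n j : nat) :
  (1 < E)%N -> n.+1 = (E ^ 2 * m)%N -> (j < m)%N ->
  `|quicksort_toll n j / n.+1%:R - 1| <= 9 / E%:R.
Proof.
move=> E1 nE jm.
have Em : (E * m <= n.+1)%N by rewrite nE -mulnn leq_mul2r leq_pmulr ?orbT // ltnW.
have m0 : (0 < m)%N by apply: leq_ltn_trans jm.
have jn : (j <= n)%N.
  by rewrite -ltnS; apply: leq_trans (leq_trans jm _) Em; rewrite leq_pmull // ltnW.
have jEm : (j + E * m <= n.+1)%N.
  rewrite nE -mulnn -mulnA; apply: leq_trans (_ : 2 * (E * m) <= _)%N;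
    last by rewrite leq_mul2r E1 orbT.
  by rewrite mul2n -addnn leq_add2r; apply: leq_trans (ltnW jm) _; rewrite leq_pmull // ltnW.
set N := n.+1%:R : R; set e := E%:R : R; set M := m%:R : R.
have N0 : 0 < N by rewrite ltr0n.
have e2 : 2 <= e by rewrite ler_nat.
have M1 : 1 <= M by rewrite ler1n.
have NE : N = e ^+ 2 * M by rewrite /N nE natrM natrX.
have jM : j.+1%:R <= M by rewrite ler_nat.
have j0 : (0 : R) < j.+1%:R by rewrite ltr0n.
set h := harmonic_sum n.+1 - harmonic_sum j.
set k := harmonic_sum n.+1 - harmonic_sum (n - j).
have h0 : 0 <= h by rewrite subr_ge0 harmonic_sum_mono // (leq_trans jn).
have k0 : 0 <= k by rewrite subr_ge0 harmonic_sum_mono // (leq_trans (leq_subr _ _)).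
have kle : (n - j).+1%:R * k <= j.+1%:R.
  have := harmonic_sumB_le (n - j) j.+1.
  by rewrite addnS subnK // ler_pdivlMr ?ltr0n // mulrC.
(* The harmonic sum is cut at [j + E * m]. The first [E * m] terms are at most [1 / j.+1] each; the
   others are fewer than [n.+1 = E ^ 2 * m] and at most [1 / (E * m)] each, so they add up to at
   most [E], with [j.+1 <= m]. *)
have hle : j.+1%:R * h <= 2 * (e * M).
  have h1 := harmonic_sumB_le j (E * m).
  have h2 := harmonic_sumB_le (j + E * m) (n.+1 - (j + E * m)).
  rewrite subnKC // in h2.
  rewrite natrM -/e -/M ler_pdivlMr // in h1.
  have h3 : (n.+1 - (j + E * m))%:R / (j + E * m).+1%:R <= e.
    rewrite ler_pdivrMr ?ltr0n //; apply: (@le_trans _ _ N).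
      by rewrite ler_nat leq_subr.
    rewrite NE expr2 -mulrA ler_wpM2l ?(le_trans _ e2) //.
    by rewrite -natrM ler_nat (leq_trans _ (leqnSn _)) // leq_addl.
  have h4 : harmonic_sum n.+1 - harmonic_sum (j + E * m) <= e := le_trans h2 h3.
  have h5 : j.+1%:R * (harmonic_sum n.+1 - harmonic_sum (j + E * m)) <= M * e.
    apply: ler_pM => //.
    by rewrite subr_ge0 harmonic_sum_mono.
  rewrite /h; nra.
have tollE : quicksort_toll n j = N + 3 - 2 * (j.+1%:R * h) - 2 * ((n - j).+1%:R * k).
  rewrite /quicksort_toll !quicksort_meanE /h /k /N.
  rewrite -!natr1 natrB //; ring.
have -> : quicksort_toll n j / N - 1 = (3 - 2 * (j.+1%:R * h) - 2 * ((n - j).+1%:R * k)) / N.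
  by rewrite tollE; field; rewrite gt_eqF.
have h1 : 0 <= j.+1%:R * h by rewrite mulr_ge0.
have k1 : 0 <= (n - j).+1%:R * k by rewrite mulr_ge0.
rewrite ler_norml ler_pdivlMr // ler_pdivrMr // mulNr NE.
(* The deviation of the toll from [N] lies between [- 5 e M] and [3], well inside the allowed
   [9 e M]. *)
have -> : 9 / e * (e ^+ 2 * M) = 9 * (e * M) by field; rewrite gt_eqF // (lt_le_trans _ e2).
have eM : 2 * M <= e * M by rewrite ler_wpM2r // (le_trans _ M1).
by apply/andP; split; lra.
Qed.

End quicksort_mean.

(** * The complex modulus and the unit circle *)

Local Notation "`| z |C" := (Normc.normc z) (at level 0, format "`| z |C").

Section expi.
Local Open Scope complex_scope.
Context (R : realType).
Implicit Types (x y : R) (z w : R[i]).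

Lemma normcD_le z w : `|z + w|C <= `|z|C + `|w|C.
Proof. exact: (@le_normcD R). Qed.

Lemma normc_opp z : `|- z|C = `|z|C.
Proof. exact: (@normcN R). Qed.

Lemma normc_ge0 z : 0 <= `|z|C.
Proof. by case: z => a b; exact: sqrtr_ge0. Qed.

Lemma normcB_le z w : `|z|C <= `|w|C + `|z - w|C.
Proof. by rewrite -[X in `|X|C <= _](subrKC w) normcD_le. Qed.

Lemma normc_distC z w : `|z - w|C = `|w - z|C.
Proof. by rewrite -normc_opp opprB. Qed.

Lemma normc_sum (I : Type) (r : seq I) (F : I -> R[i]) :
  `|\sum_(i <- r) F i|C <= \sum_(i <- r) `|F i|C.
Proof.
elim: r => [|i r IH]; first by rewrite !big_nil Normc.normc0.
by rewrite !big_cons (le_trans (normcD_le _ _)) // lerD2l.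
Qed.

Lemma normc_real x : `|x%:C|C = `|x|.
Proof. by rewrite /Normc.normc /= expr0n addr0 sqrtr_sqr. Qed.

Lemma normc_le_ReIm z : `|z|C <= `|complex.Re z| + `|complex.Im z|.
Proof.
case: z => a b /=; rewrite -(@ler_pXn2r _ 2) ?nnegrE ?sqrtr_ge0 ?addr_ge0 //.
rewrite sqr_sqrtr ?addr_ge0 ?sqr_ge0 // sqrrD !real_normK ?num_real //.
by rewrite lerD2r lerDl mulrn_wge0 // mulr_ge0.
Qed.

Lemma normc_ge_absRe z : `|complex.Re z| <= `|z|C.
Proof.
case: z => a b /=; rewrite -(@ler_pXn2r _ 2) ?nnegrE ?sqrtr_ge0 //.
by rewrite sqr_sqrtr ?addr_ge0 ?sqr_ge0 // real_normK ?num_real // lerDl sqr_ge0.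
Qed.

Lemma expiD x y : expi (x + y) = expi x * expi y.
Proof. by rewrite /expi cosD sinD; simpc; congr (_ +i* _); rewrite addrC. Qed.

Lemma expi0 : expi 0 = 1 :> R[i].
Proof. by rewrite /expi cos0 sin0. Qed.

Lemma expi_mulrn x n : expi (x *+ n) = expi x ^+ n.
Proof. by elim: n => [|n IH]; rewrite ?expi0 // mulrS exprS expiD IH. Qed.

Lemma normc_expi x : `|expi x|C = 1.
Proof. by rewrite /expi /= cos2Dsin2 sqrtr1. Qed.

Lemma sin_lip x y : `|sin x - sin y| <= `|x - y|.
Proof.
wlog xy : x y / y < x.
  move=> H; have [xy|xy|->] := ltgtP x y; [|exact: H|by rewrite !subrr].
  by rewrite distrC (distrC x); exact: H.
have [c _ ->] := @MVT R sin cos y x xy (fun t _ => is_derive_sin t)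
  (continuous_subspaceT (@continuous_sin R)).
by rewrite normrM ler_piMl // cos_max.
Qed.

Lemma cos_lip x y : `|cos x - cos y| <= `|x - y|.
Proof.
rewrite -2!sinDpihalf (le_trans (sin_lip _ _)) //.
by rewrite opprD addrACA subrr addr0.
Qed.

Lemma expi_lip x y : `|expi x - expi y|C <= 2 * `|x - y|.
Proof.
apply: le_trans (normc_le_ReIm _) _; rewrite mulr2n mulrDl mul1r.
exact: lerD (cos_lip _ _) (sin_lip _ _).
Qed.

End expi.

(** * Characteristic functions of the centered costs *)

Section centered_char_fun.
Local Open Scope complex_scope.
Context (R : realType).

(* The characteristic function of [X_n - E X_n], see [centered_char_funE]. *)
Definition centered_char_fun (n : nat) (s : R) : R[i] :=
  (map_poly (real_complex R) (quicksort_pgf R n)).[expi s] *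
  expi (- s * quicksort_mean R n).
Local Notation psi := centered_char_fun.

Lemma centered_char_fun_at0 s : psi 0 s = 1.
Proof.
rewrite /psi /quicksort_mean quicksort_pgf0 derivC hornerC mulr0 expi0.
by rewrite rmorph1 hornerC mulr1.
Qed.

(** The recursion of the generating function is evaluated at [expi s]; the [n] comparisons with the
    pivot and the three centering phases combine into the toll. *)
Lemma centered_char_funS n s : psi n.+1 s = n.+1%:R^-1 *
  \sum_(j < n.+1) expi (s * quicksort_toll R n j) * (psi j s * psi (n - j) s).
Proof.
rewrite /psi quicksort_pgfS rmorphM rmorphM rmorph_sum /=.
rewrite map_polyC map_polyXn hornerM hornerC hornerM hornerXn horner_sum.
rewrite -mulrA; congr (_ * _).
  exact: etrans (fmorphV (real_complex R) _) (congr1 _ (rmorph_nat (real_complex R) _)).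
rewrite -!mulrA.
rewrite mulr_suml mulr_sumr; apply: eq_bigr => j _.
rewrite rmorphM hornerM -expi_mulrn.
set a := _.[_]; set b := _.[_].
have -> : expi (s *+ n) * (a * b * expi (- s * quicksort_mean R n.+1)) =
  a * b * expi (s *+ n - s * quicksort_mean R n.+1).
  by rewrite expiD mulNr; ring.
have -> : s *+ n - s * quicksort_mean R n.+1 =
    s * quicksort_toll R n j - s * quicksort_mean R j - s * quicksort_mean R (n - j).
  by rewrite /quicksort_toll -mulr_natr; ring.
by rewrite !expiD !mulNr; ring.
Qed.

(** By strong induction: the recursion writes [psi n.+1 s] as a mean of products of factors of
    modulus at most [1]. *)
Lemma centered_char_fun_le1 n s : `|psi n s|C <= 1.
Proof.
elim/ltn_ind: n => -[|n] IH; first by rewrite centered_char_fun_at0 Normc.normc1.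
rewrite centered_char_funS Normc.normcM -[n.+1%:R](rmorph_nat (real_complex R)).
rewrite -(fmorphV (real_complex R)) normc_real.
rewrite ger0_norm ?invr_ge0 // mulrC ler_pdivrMr ?ltr0n // mul1r.
apply: le_trans (normc_sum _ _) _.
rewrite -[leRHS]mulr_natr mul1r -[X in X%:R](card_ord n.+1) -sumr_const.
apply: ler_sum => j _; rewrite Normc.normcM normc_expi mul1r Normc.normcM.
have nj : (n - j < n.+1)%N by rewrite ltnS leq_subr.
by apply: mulr_ile1; rewrite ?normc_ge0 // IH // ltn_ord.
Qed.

End centered_char_fun.

(** * Exponential decay of a locally uniform limit [f] of the centered characteristic functions *)

Lemma sum_nat_interval (R : pzSemiRingType) (a b n : nat) : (b <= n)%N ->
  \sum_(j < n) ((a <= j < b)%N%:R : R) = (b - a)%:R.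
Proof.
move=> bn; rewrite -natr_sum; congr _%:R.
(* With [minn b n] the claim no longer needs [b <= n], and induction on [n] applies. *)
suff -> : (\sum_(j < n) (a <= j < b) = minn b n - a)%N by rewrite (minn_idPl bn).
elim: {bn}n => [|n IH]; first by rewrite big_ord0 minn0.
rewrite big_ord_recr /= IH; lia.
Qed.

Section decay.
Local Open Scope complex_scope.
Context (R : realType).
Local Notation psi := (@centered_char_fun R).
Context (f : R -> R[i]).
Context (f0 : f 0 = 1).
Context (f_le1 : forall t, `|f t|C <= 1).
Context (f_unif : forall e : R, 0 < e ->
  exists2 d : R, 0 < d & forall t s : R, `|t - s| <= d -> `|f t - f s|C <= e).
Context (f_lim : forall T e : R, 0 < e ->
  exists N, forall (n : nat) (s : R), (N <= n)%N -> 0 <= s -> s * n%:R <= T ->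
    `|psi n s - f (s * n%:R)|C <= e).

(** The point is uniformity over all [j <= n], small ones included. For large [j] this is the
    convergence; for small [j] the point [s * j] is so close to [0] that [|f|] is almost [1], which
    bounds [|psi j s|]. *)
Lemma psi_le_f (T e : R) : 0 <= T -> 0 < e -> exists N,
  forall (n : nat) (s : R), (N <= n)%N -> 0 <= s -> s * n%:R <= T -> forall j, (j <= n)%N ->
  `|psi j s|C <= `|f (s * j%:R)|C + e.
Proof.
move=> T0 e0; have [N0 HN0] := f_lim T e0; have [d d0 Hd] := f_unif e0.
(* For such [n], every [j < N0] has [s * j <= T * N0 / n <= d]. *)
exists (Num.truncn (N0%:R * T / d)).+1 => n s Nn s0 sT j jn.
have sj : s * j%:R <= s * n%:R by rewrite ler_wpM2l // ler_nat.
have [N0j|jN0] := leqP N0 j.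
  apply: le_trans (normcB_le _ (f (s * j%:R))) _; rewrite lerD2l.
  by apply: HN0 => //; exact: le_trans sj sT.
apply: le_trans (centered_char_fun_le1 _ _) _.
apply: le_trans (_ : `|f 0|C <= _); first by rewrite f0 Normc.normc1.
apply: le_trans (normcB_le _ (f (s * j%:R))) _.
rewrite lerD2l; apply: Hd; rewrite sub0r normrN ger0_norm ?mulr_ge0 //.
have n0 : (0 : R) < n%:R by rewrite ltr0n; apply: leq_trans Nn.
apply: (@le_trans _ _ (s * N0%:R)); first by rewrite ler_wpM2l // ler_nat ltnW.
have h : N0%:R * T / d <= n%:R.
  apply: ltW; apply: lt_le_trans (truncnS_gt _) _; by rewrite ler_nat.
rewrite ler_pdivrMr // in h.
rewrite -(ler_pM2r n0) mulrAC; apply: le_trans (_ : T * N0%:R <= _).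
  by rewrite ler_wpM2r.
by rewrite mulrC [d * _]mulrC.
Qed.

(** A discrete form of the integral inequality, obtained by dropping the unimodular toll factors.
    The mesh is [t / n] and not [t / n.+1], so that the two arguments add up to exactly [t]; the
    price is to compare [f t] with [f (t + t / n)]. *)
Lemma f_le_average (t e : R) : 0 < t -> 0 < e -> exists N, forall n, (N <= n)%N ->
  `|f t|C <= e + n.+1%:R^-1 *
    \sum_(j < n.+1) `|f (t / n%:R * j%:R)|C * `|f (t / n%:R * (n - j)%:R)|C.
Proof.
move=> t0 e0; have e40 : 0 < e / 4 by rewrite divr_gt0.
have t20 : 0 <= 2 * t by rewrite mulr_ge0 // ltW.
have [N1 HN1] := psi_le_f t20 e40; have [N2 HN2] := f_lim (2 * t) e40.
have [d d0 Hd] := f_unif e40.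
exists (N1 + N2 + (Num.truncn (t / d)).+1)%N => n Nn.
have N1n : (N1 <= n)%N by rewrite (leq_trans _ Nn) // -addnA leq_addr.
have N2n : (N2 <= n)%N by rewrite (leq_trans _ Nn) // addnAC leq_addl.
have Kn : ((Num.truncn (t / d)).+1 <= n)%N by rewrite (leq_trans _ Nn) // leq_addl.
have n1 : (1 : R) <= n%:R by rewrite ler1n (leq_trans _ Kn).
have n0 : (0 : R) < n%:R by exact: lt_le_trans n1.
set s := t / n%:R; have s0 : 0 <= s by rewrite divr_ge0 // ltW.
have sn : s * n%:R = t by rewrite divfK // gt_eqF.
have st : s <= t by rewrite -sn ler_peMr.
have sd : s <= d.
  rewrite ler_pdivrMr // mulrC -ler_pdivrMr //; apply: ltW.
  by apply: lt_le_trans (truncnS_gt _) _; rewrite ler_nat.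
have snS : s * n.+1%:R = t + s by rewrite -natr1 mulrDr mulr1 sn.
have h1 : `|f t|C <= `|f (s * n.+1%:R)|C + e / 4.
  apply: le_trans (normcB_le _ (f (s * n.+1%:R))) _; rewrite lerD2l; apply: Hd.
  by rewrite snS opprD addNKr normrN ger0_norm.
have h2 : `|f (s * n.+1%:R)|C <= `|psi n.+1 s|C + e / 4.
  apply: le_trans (normcB_le _ (psi n.+1 s)) _; rewrite lerD2l normc_distC.
  by apply: HN2 => //; [exact: leqW | rewrite snS; lra].
(* Replacing each of the two factors by [|f|] costs [e / 4], since the other one is at most [1]. *)
have h3 : `|psi n.+1 s|C <= e / 2 + n.+1%:R^-1 *
    \sum_(j < n.+1) `|f (s * j%:R)|C * `|f (s * (n - j)%:R)|C.
  rewrite centered_char_funS Normc.normcM.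
  rewrite -[n.+1%:R in X in X <= _](rmorph_nat (real_complex R)).
  rewrite -(fmorphV (real_complex R)) normc_real ger0_norm ?invr_ge0 //.
  have -> : e / 2 = n.+1%:R^-1 * \sum_(j < n.+1) (e / 2).
    rewrite sumr_const card_ord -[(e / 2) *+ _]mulr_natl mulKf // pnatr_eq0 //.
  rewrite -mulrDr ler_wpM2l ?invr_ge0 // -big_split /=.
  apply: le_trans (normc_sum _ _) _; apply: ler_sum => j _.
  rewrite Normc.normcM normc_expi mul1r Normc.normcM.
  have jn : (j <= n)%N by rewrite -ltnS.
  have sT : s * n%:R <= 2 * t by rewrite sn; lra.
  have := HN1 _ _ N1n s0 sT _ jn; have := HN1 _ _ N1n s0 sT _ (leq_subr j n).
  have := centered_char_fun_le1 (n - j) s; have := f_le1 (s * j%:R).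
  have := normc_ge0 (psi (n - j) s); have := normc_ge0 (f (s * j%:R)).
  move: `|psi j s|C `|psi (n - j) s|C `|f _|C `|f _|C => a b B A A0 b0 A1 b1 bB aA.
  have h3 : a * b <= (A + e / 4) * b by rewrite ler_wpM2r.
  have h4 : A * b <= A * (B + e / 4) by rewrite ler_wpM2l.
  nra.
by move: h1 h2 h3; move: (n.+1%:R^-1 * _) => S; lra.
Qed.

(** Let [w = expi t * f t]. A proportion [a] of the terms of the recursion is close to [w], so
    [|f t - a w|] is at most about [1 - a]. But [f t - a w = f t * (1 - a * expi t)], and the last
    factor has real part [1 - a cos t], which exceeds [1 - a] by a fixed amount. *)
Lemma f_lt1_quarter_one : exists2 c : R, 0 < c &
  forall t : R, 4^-1 <= t -> t <= 1 -> `|f t|C <= 1 - 2 * c.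
Proof.
(* The least value of [1 - cos t] for [t] in [[1/4, 1]]. *)
pose k : R := 1 - cos 4^-1.
have k0 : 0 < k.
  have pi2 := pi_ge2 R.
  by rewrite subr_gt0 -[ltRHS]cos0 ltr_cos ?in_itv /= ?lexx; lra.
have k2 : k <= 2 by have := cos_geN1 (4^-1 : R); rewrite /k; lra.
have e0 : 0 < k / 32 by lra.
have [d d0 Hd] := f_unif e0; have [N0 HN0] := f_lim 1 e0.
(* The toll error [9 / E], doubled by [expi_lip], must be at most [k / 8]; and [1 / E <= d] will
   make [s * m <= d]. *)
have [E [E1 Ek Ed]] : exists E : nat, [/\ (1 < E)%N, 18 / E%:R <= k / 8 & 1 / E%:R <= d].
  pose K := Num.truncn (144 / k); pose D := Num.truncn d^-1.
  have E0 : (0 : R) < (K.+2 + D)%:R by rewrite ltr0n.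
  exists (K.+2 + D)%N; split=> //.
    have h : 144 / k <= (K.+2 + D)%:R.
      apply: ltW; apply: lt_le_trans (truncnS_gt _) _.
      by rewrite ler_nat (leq_trans (leqnSn _)) // leq_addr.
    by rewrite ler_pdivrMr // in h; rewrite ler_pdivrMr //; lra.
  have h : d^-1 <= (K.+2 + D)%:R.
    apply: ltW; apply: lt_le_trans (truncnS_gt _) _.
    by rewrite ler_nat addSn ltnS addSn (leq_trans _ (leqnSn _)) // leq_addl.
  by rewrite ler_pdivrMr // mulrC -ler_pdivrMr // mul1r.
have Er : (2 : R) <= E%:R by rewrite ler_nat.
have E0 : (0 : R) < E%:R by lra.
(* This precision is at most [a * k / 4], because [a] will be at least [1 / (2 E ^ 2)]. *)
have e30 : 0 < k / 8 / E%:R ^+ 2 by rewrite divr_gt0 ?exprn_gt0 //; lra.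
have [N3 HN3] := f_lim 1 e30.
(* The first condition says that at least half of the indices below [m] are at least [N0], where the
   convergence of [psi j] can be used. *)
have [m [mN0 mN3 mm0]] : exists m, [/\ (m <= (m - N0) * 2)%N, (N3 <= m)%N & (0 < m)%N].
  by exists (N0 + (N0 + N3).+1)%N; split; clear; lia.
have [n nE] : exists n, n.+1 = (E ^ 2 * m)%N.
  by exists (E ^ 2 * m).-1; rewrite prednK // muln_gt0 expn_gt0 (ltnW E1).
have mn : (m * 2 <= n.+1)%N.
  by rewrite nE mulnC leq_mul2r (leq_trans E1) ?orbT // -mulnn leq_pmulr // ltnW.
pose a : R := (m - N0)%:R / n.+1%:R.
have nn : n.+1%:R = E%:R ^+ 2 * m%:R :> R by rewrite nE natrM natrX.
have m0 : (0 : R) < m%:R by rewrite ltr0n.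
have n0 : (0 : R) < n.+1%:R by rewrite ltr0n.
have ale : a <= 1 / 2.
  rewrite /a ler_pdivrMr //.
  have : (m * 2)%:R <= n.+1%:R :> R by rewrite ler_nat.
  have : (m - N0)%:R <= m%:R :> R by rewrite ler_nat leq_subr.
  by rewrite natrM; lra.
have age : 1 / 2 / E%:R ^+ 2 <= a.
  rewrite /a ler_pdivlMr // nn mulrA divfK; last by rewrite expf_neq0 // gt_eqF.
  have : m%:R <= ((m - N0) * 2)%:R :> R by rewrite ler_nat.
  by rewrite natrM; lra.
have a0 : 0 < a by apply: lt_le_trans age; rewrite !divr_gt0 // exprn_gt0.
exists (a * k / 8); first by rewrite divr_gt0 // mulr_gt0.
move=> t t4 t1; pose s := t / n.+1%:R.
have t0 : 0 <= t by lra.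
have s0 : 0 <= s by rewrite divr_ge0.
have sn : s * n.+1%:R = t by rewrite /s divfK // gt_eqF.
have sm : s * m%:R <= d.
  apply: le_trans Ed; rewrite ler_pdivlMr //.
  have : s * n.+1%:R <= 1 by rewrite sn.
  rewrite nn; have := mulr_ge0 s0 (ltW m0); nra.
pose w := expi t * f t.
have near1 (j : 'I_n.+1) : (N0 <= j < m)%N ->
    `|expi (s * quicksort_toll R n j) * (psi j s * psi (n - j) s) - w|C <= k / 4.
  move=> /andP[Nj jm].
  have jn : (j <= n)%N by rewrite -ltnS.
  have Nnj : (N0 <= n - j)%N.
    by move: (nat_of_ord j) mN0 mn jm Nj => i; clear; lia.
  have sT (i : nat) : (i <= n.+1)%N -> s * i%:R <= 1.
    by move=> iN; apply: le_trans t1; rewrite -sn ler_wpM2l // ler_nat.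
  have sjd (i : nat) : (i <= m)%N -> s * i%:R <= d.
    by move=> im; apply: le_trans sm; rewrite ler_wpM2l // ler_nat.
  have h1 : `|expi (s * quicksort_toll R n j) - expi t|C <= k / 8.
    apply: le_trans (expi_lip _ _) _; apply: le_trans Ek.
    have -> : s * quicksort_toll R n j - t = t * (quicksort_toll R n j / n.+1%:R - 1).
      by rewrite /s; field; rewrite gt_eqF.
    have := quicksort_toll_near R E1 nE jm.
    rewrite normrM (ger0_norm t0); move: (normr_ge0 (quicksort_toll R n j / n.+1%:R - 1)).
    move: `|_ - 1| => x x0 xE.
    have : t * x <= 1 * (9 / E%:R) by apply: ler_pM.
    lra.
  have h2 : `|psi j s - 1|C <= k / 16.
    have -> : psi j s - 1 = (psi j s - f (s * j%:R)) + (f (s * j%:R) - f 0).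
      by rewrite f0 addrA subrK.
    apply: le_trans (normcD_le _ _) _.
    have := HN0 j s Nj s0 (sT _ (leqW jn)).
    have : `|f (s * j%:R) - f 0|C <= k / 32.
      by apply: Hd; rewrite subr0 ger0_norm ?mulr_ge0 // sjd // ltnW.
    lra.
  have h3 : `|psi (n - j) s - f t|C <= k / 16.
    have -> : psi (n - j) s - f t =
      (psi (n - j) s - f (s * (n - j)%:R)) + (f (s * (n - j)%:R) - f t).
      by rewrite addrA subrK.
    apply: le_trans (normcD_le _ _) _.
    have := HN0 (n - j)%N s Nnj s0 (sT _ (leq_trans (leq_subr _ _) (leqnSn _))).
    have : `|f (s * (n - j)%:R) - f t|C <= k / 32.
      apply: Hd; rewrite -sn distrC -mulrBr -natrB; last by rewrite leqW // leq_subr.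
      rewrite ger0_norm ?mulr_ge0 // sjd //.
      by move: (nat_of_ord j) jn jm => i; clear; lia.
    lra.
  have := centered_char_fun_le1 j s; have := centered_char_fun_le1 (n - j) s.
  rewrite /w; move: (psi j s) (psi (n - j) s) (expi (s * _)) h2 h3 h1.
  move=> p q g h2 h3 h1 q1 p1.
  (* The three differences contribute [k / 8], [k / 16] and [k / 16]. *)
  have -> : g * (p * q) - expi t * f t = (g - expi t) * (p * q) +
      (expi t * ((p - 1) * q) + expi t * (q - f t)) by ring.
  apply: le_trans (normcD_le _ _) _.
  have := normcD_le (expi t * ((p - 1) * q)) (expi t * (q - f t)).
  rewrite !Normc.normcM normc_expi !mul1r.
  have := normc_ge0 p; have := normc_ge0 q; have := normc_ge0 (p - 1).
  have := normc_ge0 (g - expi t).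
  move: h1 h2 h3 p1 q1; move: `|g - _|C `|p - 1|C `|q - f t|C `|p|C `|q|C.
  move=> x y z p' q' xk yk zk p1 q1 x0 y0 q0 p0.
  have h1 : x * (p' * q') <= x by rewrite ler_piMr // mulr_ile1.
  have h2 : y * q' <= y by rewrite ler_piMr.
  lra.
(* The indices outside [[N0, m)] contribute [1 - a], those inside at most [a * k / 4], and replacing
   [f t] by [psi n.+1 s] another [a * k / 4]. *)
have main : `|f t - a%:C * w|C <= 1 - a + a * k / 2.
  have -> : f t - a%:C * w = (f t - psi n.+1 s) + (psi n.+1 s - a%:C * w).
    by rewrite addrA subrK.
  apply: le_trans (normcD_le _ _) _.
  have h1 : `|f t - psi n.+1 s|C <= a * k / 4.
    rewrite normc_distC -{1}sn; apply: le_trans (HN3 n.+1 s _ s0 _) _.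
    - rewrite (leq_trans mN3) // (leq_trans _ mn) // leq_pmulr //.
    - by rewrite sn.
    - have -> : k / 8 / E%:R ^+ 2 = 1 / 2 / E%:R ^+ 2 * (k / 4).
        by field; rewrite gt_eqF.
      by rewrite -(mulrA a) ler_wpM2r //; lra.
  have h2 : `|psi n.+1 s - a%:C * w|C <= 1 - (1 - k / 4) * a.
    have -> : psi n.+1 s - a%:C * w = (n.+1%:R^-1)%:C * \sum_(j < n.+1)
       (expi (s * quicksort_toll R n j) * (psi j s * psi (n - j) s) -
        ((N0 <= j < m)%N%:R : R)%:C * w).
      rewrite sumrB mulrBr centered_char_funS -mulr_suml -rmorph_sum /=.
      rewrite sum_nat_interval; last by rewrite (leq_trans _ mn) // leq_pmulr.
      congr (_ - _).
        by rewrite (fmorphV (real_complex R)) (rmorph_nat (real_complex R)).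
      by rewrite /a [_%:R / _]mulrC (rmorphM (real_complex R)) -mulrA.
    rewrite Normc.normcM normc_real ger0_norm ?invr_ge0 //.
    rewrite mulrC ler_pdivrMr //; apply: le_trans (normc_sum _ _) _.
    have -> : (1 - (1 - k / 4) * a) * n.+1%:R =
        \sum_(j < n.+1) (1 - (1 - k / 4) * (N0 <= j < m)%N%:R).
      rewrite sumrB sumr_const card_ord -mulr_sumr sum_nat_interval; last first.
        by rewrite (leq_trans _ mn) // leq_pmulr.
      by rewrite mulrBl mul1r -mulrA /a divfK // gt_eqF.
    apply: ler_sum => j _; have := near1 j.
    case: (N0 <= j < m)%N => [/(_ isT) h|_].
      by rewrite mul1r mulr1 opprB addrCA subrr addr0.
    rewrite mulr0 subr0 mul0r subr0 Normc.normcM normc_expi mul1r Normc.normcM.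
    by rewrite mulr_ile1 ?normc_ge0 ?centered_char_fun_le1.
  lra.
have eq : f t - a%:C * w = f t * (1 - a%:C * expi t) by rewrite /w; ring.
rewrite eq Normc.normcM in main.
have h : 1 - a + a * k <= `|1 - a%:C * expi t|C.
  apply: le_trans (normc_ge_absRe _); apply: le_trans (ler_norm _).
  rewrite /expi; simpc => /=.
  have : cos t <= cos 4^-1.
    have pi2 := pi_ge2 R.
    move: t4; rewrite le_eqVlt => /orP[/eqP <- //|t4].
    apply: ltW; rewrite ltr_cos ?in_itv //=; apply/andP; split; lra.
  rewrite -[cos 4^-1](subKr 1) -/k; nra.
have {}main : `|f t|C * (1 - a + a * k) <= 1 - a + a * k / 2.
  by apply: le_trans main; rewrite ler_wpM2l ?normc_ge0.
have ak : 0 < a * k by rewrite mulr_gt0.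
have ak1 : a * k <= 1 / 2 * 2 by apply: ler_pM => //; exact: ltW.
have D0 : 0 < 1 - a + a * k by lra.
(* With [D = 1 - a + a * k], [main] reads [|f t| * D <= D - a * k / 2]; as [D <= 2], this gives
   [|f t| <= 1 - a * k / 4], whence the choice of the witness. *)
rewrite -(ler_pM2r D0) (le_trans main) //.
have : a * k * (1 - a + a * k) <= a * k * 2 by rewrite ler_wpM2l //; lra.
lra.
Qed.

(* The only pairs [x + y = t] with [m x * m y > 1] are those where [x] or [y]
   is below [1/4]; they are about twice as many as the pairs with
   [1/4 <= x <= 1/2], where the product is at most [1 - c]. *)
Lemma decay_step (c eta t : R) (m := fun x : R => expR (eta * x) * `|f x|C) :
  0 < c -> 1 <= t ->
  (forall x : R, 0 <= x -> x <= 4^-1 -> m x <= 1 + c / 8) ->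
  (forall x, 4^-1 <= x -> x <= 2^-1 -> m x <= 1 - c) ->
  (forall x, 4^-1 <= x -> x <= t -> m x <= 1) ->
  m t < 1.
Proof.
move=> c0 t1 m1 m2 m3; have t0 : 0 < t by lra.
(* Once multiplied by [expR (eta * t)], this error becomes [c / (64 * t)], half of the gain
   [c / (32 * t)] obtained at the end. *)
have e0 : 0 < c / (64 * t) / expR (eta * t).
  by rewrite !divr_gt0 ?expR_gt0 // mulr_gt0.
have [N HN] := f_le_average t0 e0.
pose n := (N + (Num.truncn (8 * t)).+1)%N.
have {HN} := HN n (leq_addr _ _).
have n8 : 8 * t <= n%:R.
  by apply: ltW; apply: lt_le_trans (truncnS_gt _) _; rewrite ler_nat leq_addl.
have n1 : (1 : R) <= n%:R by lra.
move: {N}n n8 n1 => n n8 n1 HN.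
have n0 : (0 : R) < n%:R by lra.
have tn0 : 0 <= n%:R / (4 * t) by rewrite divr_ge0 // ?ltW // mulr_gt0.
have /andP[pn np] := truncn_itv tn0.
(* [p] is the last index with [s * p <= 1/4]; the condition [8 * t <= n] makes it positive. *)
move: (Num.truncn _) pn np => p pn np.
have pe : n%:R / (4 * t) = n%:R / t / 4 by field; rewrite gt_eqF.
have n8' : 8 <= n%:R / t by rewrite ler_pdivlMr.
have p1 : (1 : R) <= p%:R.
  by rewrite ler1n lt0n; apply/eqP => p0; move: np; rewrite pe p0; lra.
have pt : n.+1%:R / t <= 16 * p%:R.
  have h : n.+1%:R / t <= n%:R / t * 2.
    by rewrite mulrAC ler_pM2r ?invr_gt0 // -[n.+1%:R]natr1; lra.
  move: np; rewrite pe -[p.+1%:R]natr1; lra.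
set s := t / n%:R in HN; have s0 : 0 <= s by rewrite divr_ge0 // ltW.
have sn : s * n%:R = t by rewrite /s divfK // gt_eqF.
have low (i : nat) : (i <= p)%N -> s * i%:R <= 4^-1.
  move=> ip; apply: (@le_trans _ _ (s * (n%:R / (4 * t)))).
    by rewrite ler_wpM2l // (le_trans _ pn) // ler_nat.
  by rewrite mulrA sn; have -> : t / (4 * t) = 4^-1 by field; rewrite gt_eqF.
have high (i : nat) : (p < i)%N -> 4^-1 <= s * i%:R.
  move=> ip; apply: (@le_trans _ _ (s * (n%:R / (4 * t)))).
    by rewrite mulrA sn; have -> : t / (4 * t) = 4^-1 by field; rewrite gt_eqF.
  by rewrite ler_wpM2l // (le_trans (ltW np)) // ler_nat.
have mid (i : nat) : (i <= p * 2)%N -> s * i%:R <= 2^-1.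
  move=> ip; have : s * i%:R <= s * (p * 2)%:R by rewrite ler_wpM2l // ler_nat.
  rewrite natrM mulrA; have := low p (leqnn p); lra.
have m0 x : 0 <= m x by rewrite mulr_ge0 ?expR_ge0 ?normc_ge0.
have xt (i : nat) : (i <= n)%N -> s * i%:R <= t.
  by move=> i_n; rewrite -[leRHS]sn ler_wpM2l // ler_nat.
have si0 (i : nat) : 0 <= s * i%:R by rewrite mulr_ge0.
(* Since the two arguments add up to [t >= 1], they are never both below [1/4], nor is one below
   [1/4] while the other is at most [1/2]; hence the correction terms are never in force
   together. *)
have prod (j : 'I_n.+1) : m (s * j%:R) * m (s * (n - j)%:R) <=
    1 + c / 8 * ((0 <= j < p.+1)%N%:R + (0 <= n - j < p.+1)%N%:R)
      - c * (p.+1 <= j < (p * 2).+1)%N%:R.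
  have jn : (j <= n)%N by rewrite -ltnS.
  have yE : s * (n - j)%:R = t - s * j%:R by rewrite natrB // mulrBr sn.
  have := m0 (s * j%:R); have := m0 (s * (n - j)%:R).
  rewrite !leq0n !andTb !ltnS.
  have [jp|pj] := leqP j p; have [np'|pn'] := leqP (n - j)%N p.
  - by have := low _ jp; have := low _ np'; lra.
  - have := m1 _ (si0 j) (low _ jp); have := m3 _ (high _ pn') (xt _ (leq_subr _ _)).
    move: (m _) (m _) => y x y1 x1 y0 x0; rewrite addr0 mulr0 subr0 mulr1; nra.
  - have := m1 _ (si0 _) (low _ np'); have [jp2|_] := leqP j (p * 2)%N.
      by have := low _ np'; have := mid _ jp2; lra.
    have := m3 _ (high _ pj) (xt _ jn).
    move: (m _) (m _) => x y x1 y1 y0 x0; rewrite add0r mulr0 subr0 mulr1; nra.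
  - have := m3 _ (high _ pn') (xt _ (leq_subr j n)); have [jp2|_] := leqP j (p * 2)%N.
      have := m2 _ (high _ pj) (mid _ jp2).
      move: (m _) (m _) => x y x1 y1 y0 x0; rewrite addr0 mulr0 addr0 mulr1; nra.
    have := m3 _ (high _ pj) (xt _ jn).
    move: (m _) (m _) => x y x1 y1 y0 x0; rewrite addr0 !mulr0 subr0 addr0; nra.
have pn2 : ((p * 2).+1 <= n.+1)%N.
  rewrite ltnS -(@ler_nat R) natrM.
  have : n%:R / t <= n%:R by rewrite ler_pdivrMr // ler_peMr // ltW.
  by move: pn; rewrite pe; lra.
have pn1 : (p.+1 <= n.+1)%N by rewrite (leq_trans _ pn2) // ltnS leq_pmulr.
(* The excess is [c / 4 * p.+1], at most [c / 2 * p] because [p >= 1], against a saving of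
   [c * p]. *)
have sum_le : \sum_(j < n.+1) m (s * j%:R) * m (s * (n - j)%:R) <=
    n.+1%:R - c / 2 * p%:R.
  apply: le_trans (ler_sum _ (fun j _ => prod j)) _.
  rewrite sumrB big_split /= sumr_const card_ord -!mulr_sumr big_split /=.
  have -> : \sum_(j < n.+1) ((0 <= n - j < p.+1)%N%:R : R) =
      \sum_(j < n.+1) (0 <= j < p.+1)%N%:R.
    rewrite (reindex_inj rev_ord_inj) /=; apply: eq_bigr => j _.
    by rewrite subSS subKn // -ltnS.
  rewrite !sum_nat_interval // subn0 subSS -[p.+1%:R]natr1.
  have -> : (p * 2 - p = p)%N by rewrite muln2 -addnn addnK.
  have cp : c <= c * p%:R by rewrite ler_peMr // ltW.
  by move: n.+1%:R => q; lra.
(* The weight [expR (eta * t)] splits exactly over the two arguments, since they add up to [t]. *)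
have mt : m t <= c / (64 * t) + n.+1%:R^-1 *
    \sum_(j < n.+1) m (s * j%:R) * m (s * (n - j)%:R).
  rewrite /m; apply: le_trans (ler_wpM2l (expR_ge0 (eta * t)) HN) _.
  rewrite mulrDr [X in X + _]mulrC divfK ?gt_eqF ?expR_gt0 // lerD2l.
  rewrite mulrCA ler_wpM2l ?invr_ge0 // mulr_sumr; apply: ler_sum => j _.
  have jn : (j <= n)%N by rewrite -ltnS.
  rewrite mulrACA -expRD -mulrDr -mulrDr -natrD subnKC // sn; exact: lexx.
apply: le_lt_trans mt _.
have : n.+1%:R^-1 * \sum_(j < n.+1) m (s * j%:R) * m (s * (n - j)%:R) <=
    1 - c / (32 * t).
  rewrite mulrC ler_pdivrMr ?ltr0n //; apply: le_trans sum_le _.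
  rewrite mulrBl mul1r lerB //.
  have -> : c / (32 * t) * n.+1%:R = c / 32 * (n.+1%:R / t) by field; rewrite gt_eqF.
  have : c * (n.+1%:R / t) <= c * (16 * p%:R) by rewrite ler_wpM2l // ltW.
  lra.
have : c / (64 * t) < c / (32 * t).
  by rewrite ltr_pM2l // ltf_pV2 ?posrE ?mulr_gt0 // ltr_pM2r // ltr_nat.
move: (n.+1%:R^-1 * _) (c / (64 * t)) (c / (32 * t)) => x y z; lra.
Qed.

Lemma f_exp_decay : exists2 eta : R, 0 < eta &
  forall t : R, 1 <= t -> `|f t|C <= expR (- eta * t).
Proof.
have [c c0 fc] := f_lt1_quarter_one.
(* Chosen so that [expR (eta * x) <= 1 + c / 8] on [[0, 1]]; then
   [m <= (1 + c / 8) * (1 - 2 * c) <= 1 - c] on [[1/4, 1]]. *)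
pose eta := ln (1 + c / 8).
have c8 : 1 < 1 + c / 8 by lra.
have eta0 : 0 < eta by rewrite ln_gt0.
exists eta => // t1 t11; rewrite mulNr expRN -[leRHS]mul1r.
rewrite ler_pdivlMr ?expR_gt0 // mulrC.
pose m := fun x : R => expR (eta * x) * `|f x|C.
rewrite -/(m t1) leNgt; apply/negP => mt1.
have fcont : continuous (fun x => `|f x|C : R).
  move=> x; apply/cvgrPdist_le => e e0; have [d d0 Hd] := f_unif e0.
  near=> y.
  have xy : `|x - y| <= d.
    by near: y; apply/nbhs_ballP; exists d => // z /=; rewrite /ball /= => /ltW.
  have := normcB_le (f x) (f y); have := normcB_le (f y) (f x).
  have := Hd _ _ xy; rewrite (normc_distC (f y)) ler_norml => h1 h2 h3.
  by apply/andP; split; lra.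
have mcont : continuous m.
  move=> x; apply: cvgM; last exact: fcont.
  by apply: continuous_comp; [exact: mulrl_continuous|exact: continuous_expR].
have E x : x <= 1 -> expR (eta * x) <= 1 + c / 8.
  move=> x1; rewrite -[leRHS]lnK ?posrE; last by lra.
  by rewrite ler_expR -/eta; nra.
have ma x : 0 <= x -> x <= 4^-1 -> m x <= 1 + c / 8.
  move=> x0 x4; rewrite -[leRHS]mulr1 ler_pM ?expR_ge0 ?normc_ge0 ?f_le1 ?E //; lra.
have mb x : 4^-1 <= x -> x <= 1 -> m x <= 1 - c.
  move=> x4 x1; have h1 := E _ x1; have h2 := fc _ x4 x1.
  have h : m x <= (1 + c / 8) * (1 - 2 * c).
    by rewrite ler_pM ?expR_ge0 ?normc_ge0.
  nra.
(* A first-failure argument: at the infimum [u] of the points where [m > 1], continuity from the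
   left gives [m u <= 1], [decay_step] makes this strict, and then [m < 1] just to the right of [u],
   where [S] must have points. *)
pose S := [set x | 1 <= x /\ 1 < m x]%classic.
have Slb : lbound S 1 by move=> x [].
have Sinf : has_inf S by split; [exists t1|exists 1].
set u := inf S.
have u1 : 1 <= u by apply: lb_le_inf => //; exists t1.
have below x : 4^-1 <= x -> x < u -> m x <= 1.
  move=> x4 xu; have [x1|x1] := leP x 1; first by have := mb _ x4 x1; lra.
  rewrite leNgt; apply/negP => mx.
  by have := ge_inf (ex_intro _ 1 Slb) (conj (ltW x1) mx : S x); rewrite leNgt xu.
have mu : m u <= 1.
  rewrite leNgt; apply/negP => mu.
  have := cvgr_gt (m u) (mcont u) 1 mu; rewrite near_nbhs => -[e /= e0 He].
  have [u11|u11] := leP u 1.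
    by have := mb u; rewrite u11; lra.
  (* A point of [[1, u)] close enough to [u] for [m] to exceed [1] there. *)
  pose x := Num.max 1 (u - e / 2).
  have xu : x < u by rewrite gt_max u11 /=; lra.
  have x1 : 1 <= x by rewrite le_max lexx.
  have xe : u - e / 2 <= x by rewrite le_max lexx orbT.
  have mx : 1 < m x by apply: He; rewrite /ball /= ger0_norm; lra.
  have : m x <= 1 by apply: below => //; lra.
  lra.
have mu1 : m u < 1.
  apply: (decay_step c0 u1 ma) => x x4 x2; first by apply: mb; lra.
  by move: x2; rewrite le_eqVlt => /orP[/eqP ->//|]; exact: below.
have := cvgr_lt (m u) (mcont u) 1 mu1; rewrite near_nbhs => -[e /= e0 He].
have [x [x1 mx] xu] := inf_adherent e0 Sinf.
have ux : u <= x by apply: ge_inf => //; exists 1.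
have : m x < 1 by apply: He; rewrite /ball /= distrC ger0_norm; [lra|lra].
lra.
Unshelve. all: by end_near.
Qed.

End decay.

(** * From the uniform measure on permutations to finite sums *)

Lemma perm_list_permutations (n : nat) :
  perm_eq [seq perm_list s | s <- enum {: 'S_n}] (permutations (iota 1 n)).
Proof.
have inj : injective (@perm_list n).
  move=> s t /eq_in_map st; apply/permP => i; apply: val_inj.
  by have [] := st i (mem_enum _ _).
have sub : {subset [seq perm_list s | s <- enum {: 'S_n}] <= permutations (iota 1 n)}.
  move=> _ /mapP[s _ ->]; rewrite mem_permutations.
  apply: uniq_perm; rewrite ?iota_uniq //.
    by rewrite map_inj_uniq ?enum_uniq // => i j [] /val_inj /perm_inj.
  move=> k; rewrite mem_iota; apply/mapP/idP => [[i _ ->]|/andP[k0 kn]].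
    by rewrite /= add1n ltnS ltn_ord.
  have kn' : (k.-1 < n)%N by rewrite -ltnS prednK.
  exists ((s^-1)%g (Ordinal kn')); first by rewrite mem_enum.
  by rewrite permKV /= prednK.
have us : uniq [seq perm_list s | s <- enum {: 'S_n}].
  by rewrite map_inj_uniq ?enum_uniq.
apply: uniq_perm => //; first exact: permutations_uniq.
(* Surjectivity comes from counting: both lists have [n!] entries. *)
apply: (uniq_min_size us sub _).2.
by rewrite size_permutations ?iota_uniq // size_iota size_map -cardE card_Sn.
Qed.

Lemma sum_perm_list (V : nmodType) (n : nat) (F : seq nat -> V) :
  \sum_(s : 'S_n) F (perm_list s) = \sum_(p <- permutations (iota 1 n)) F p.
Proof. by rewrite -(perm_big _ (perm_list_permutations n)) /= big_map big_enum. Qed.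

Section finite_expectation.
Local Open Scope complex_scope.
Context (R : realType).

Lemma integral_unif_perm (n : nat) (h : 'S_n -> \bar R) : (forall s, 0 <= h s)%E ->
  (\int[@unif_perm R n]_s h s = (n`!%:R^-1)%:E * \sum_(s : 'S_n) h s)%E.
Proof.
move=> h0.
have mh : @measurable_fun _ _ 'S_n _ setT h by move=> _ B _.
rewrite (eq_measure_integral (mscale ((n`!)%:R^-1 : R)%:nng%R
    (msum (fun k => \d_(nth (1%g : 'S_n) (enum {: 'S_n}) k)) #|{: 'S_n}|))); last first.
  by move=> A _ _; exact: unif_permE.
rewrite ge0_integral_mscale //= ge0_integral_measure_sum //; congr (_ * _)%E.
transitivity (\sum_(k < #|{: 'S_n}|) h (nth (1%g : 'S_n) (enum {: 'S_n}) k))%E.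
  by apply: eq_bigr => k _; rewrite integral_dirac // diracT mul1e.
rewrite -(big_mkord xpredT (fun k => h (nth (1%g : 'S_n) (enum {: 'S_n}) k))).
by rewrite cardE -(big_nth _ xpredT h) big_enum.
Qed.

Lemma expectation_unif_perm (n : nat) (h : 'S_n -> R) :
  ('E_(@unif_perm R n)[h] = (n`!%:R^-1 * \sum_(s : 'S_n) h s)%R%:E)%E.
Proof.
rewrite unlock integralE !integral_unif_perm //.
have pos (g : 'S_n -> R) : (\sum_(s : 'S_n) (EFin \o g)^\+ s = (\sum_s Num.max (g s) 0)%:E)%E.
  by rewrite -sumEFin; apply: eq_bigr => s _; rewrite funeposE /= EFin_max.
have neg (g : 'S_n -> R) : (\sum_(s : 'S_n) (EFin \o g)^\- s = (\sum_s Num.max (- g s) 0)%:E)%E.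
  by rewrite -sumEFin; apply: eq_bigr => s _; rewrite funenegE /= EFin_max.
rewrite [X in (_ * X - _)%E]pos [X in (_ - _ * X)%E]neg -!EFinM -EFinB -mulrBr -sumrB.
congr (_ * _)%:E; apply: eq_bigr => s _.
have [h0|h0] := leP 0 (h s).
  by rewrite max_r ?subr0 // oppr_le0.
by rewrite max_l ?sub0r ?opprK // oppr_ge0 ltW.
Qed.

(** Identifies the centering in the normalized cost with the mean read off the generating
    function. *)
Lemma fine_expectation_steps (n : nat) :
  fine 'E_(@unif_perm R n)[@quicksort_steps R n]%E = quicksort_mean R n.
Proof.
rewrite expectation_unif_perm /= /quicksort_mean /quicksort_pgf.
rewrite derivM derivC mul0r add0r hornerM hornerC; congr (_ * _).
rewrite /quicksort_steps (sum_perm_list _ (fun p => (quicksort p).2%:R : R)).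
rewrite raddf_sum horner_sum; apply: eq_bigr => p _.
by rewrite /= derivXn hornerMn hornerXn expr1n.
Qed.

Lemma centered_char_funE (n : nat) (u : R) : (0 < n)%N ->
  centered_char_fun n (u / n%:R) =
  (n`!%:R^-1)%:C * \sum_(s : 'S_n) expi (u * quicksort_normalized R s).
Proof.
move=> n0; have n0' : (n%:R : R) != 0 by rewrite pnatr_eq0 -lt0n.
rewrite /centered_char_fun /quicksort_pgf rmorphM /= map_polyC hornerM hornerC.
rewrite -mulrA; congr (_ * _).
rewrite rmorph_sum horner_sum mulr_suml.
rewrite -(sum_perm_list _ (fun p => (map_poly (real_complex R) ('X ^+ (quicksort p).2)).[
   expi (u / n%:R)] * expi (- (u / n%:R) * quicksort_mean R n))).
apply: eq_bigr => s _.
rewrite map_polyXn hornerXn -expi_mulrn -expiD; congr expi.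
by rewrite /quicksort_normalized fine_expectation_steps /quicksort_steps -mulr_natr; field.
Qed.

Lemma centered_char_fun_ReIm (n : nat) (u : R) : (0 < n)%N ->
  centered_char_fun n (u / n%:R) =
  (fine 'E_(@unif_perm R n)[fun s => cos (u * quicksort_normalized R s)]%E +i*
   fine 'E_(@unif_perm R n)[fun s => sin (u * quicksort_normalized R s)]%E).
Proof.
move=> n0; rewrite centered_char_funE // !expectation_unif_perm /=.
rewrite [\sum_(s : 'S_n) expi _](_ : _ =
  (\sum_(s : 'S_n) cos (u * quicksort_normalized R s)) +i*
  (\sum_(s : 'S_n) sin (u * quicksort_normalized R s))); first by simpc.
by elim/big_rec3: _ => // s x y z _ ->; rewrite /expi; simpc.
Qed.

End finite_expectation.

(** * A bounded test function controlling oscillations *)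

Section truncated_norm.
Local Open Scope complex_scope.
Context (R : realType).

(** Up to a factor, it dominates the change of [expi (t * x)] when [t] moves by at most [d]. Being
    bounded and continuous in [x], it is a valid test function for convergence in distribution, so
    it gives moduli of continuity that are uniform in [n]. *)
Definition truncated_norm (d x : R) : R := Num.min 1 (d * `|x|).

Lemma truncated_norm_ge0 d x : 0 <= d -> 0 <= truncated_norm d x.
Proof. by move=> d0; rewrite le_min ler01 mulr_ge0. Qed.

Lemma truncated_norm_le1 d x : truncated_norm d x <= 1.
Proof. by rewrite ge_min lexx. Qed.

Lemma truncated_norm_bounded d x : 0 <= d -> `|truncated_norm d x| <= 1.
Proof. by move=> d0; rewrite ger0_norm ?truncated_norm_le1 ?truncated_norm_ge0. Qed.

Lemma continuous_truncated_norm d : continuous (truncated_norm d).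
Proof.
move=> x; apply: (@continuous_min _ _ (cst 1) (fun x => d * `|x|)).
  exact: cvg_cst.
by apply: cvgMr; exact: norm_continuous.
Qed.

Lemma cos_truncated_norm d t s x : `|t - s| <= d ->
  `|cos (t * x) - cos (s * x)| <= 2 * truncated_norm d x.
Proof.
move=> ts; rewrite /truncated_norm minr_pMr // mulr1 le_min; apply/andP; split.
  by have := cos_max (t * x); have := cos_max (s * x); rewrite !ler_norml; lra.
rewrite (le_trans (cos_lip _ _)) // -mulrBl normrM.
have : `|t - s| * `|x| <= d * `|x| by rewrite ler_wpM2r.
have : 0 <= `|t - s| * `|x| by rewrite mulr_ge0.
lra.
Qed.

Lemma sin_truncated_norm d t s x : `|t - s| <= d ->
  `|sin (t * x) - sin (s * x)| <= 2 * truncated_norm d x.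
Proof.
move=> ts; rewrite /truncated_norm minr_pMr // mulr1 le_min; apply/andP; split.
  by have := sin_max (t * x); have := sin_max (s * x); rewrite !ler_norml; lra.
rewrite (le_trans (sin_lip _ _)) // -mulrBl normrM.
have : `|t - s| * `|x| <= d * `|x| by rewrite ler_wpM2r.
have : 0 <= `|t - s| * `|x| by rewrite mulr_ge0.
lra.
Qed.

End truncated_norm.

(** * Expectations of bounded continuous functions of a random variable *)

Section bounded_expectation.
Local Open Scope complex_scope.
Context (R : realType) (d : measure_display) (T : measurableType d).
Context (P : probability T R) (Y : {RV P >-> R}).

Lemma integrable_bounded_comp (h : R -> R) (M : R) : continuous h ->
  (forall x, `|h x| <= M) -> P.-integrable setT (EFin \o (h \o Y)).
Proof.
move=> hc hM; apply: measurable_bounded_integrable => //.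
- by rewrite (le_lt_trans (probability_le1 P measurableT)) ?ltry.
- by apply: measurableT_comp => //; exact: continuous_measurable_fun.
- exists M; split; first exact: num_real.
  by move=> x Mx w _ /=; rewrite (le_trans (hM _)) // ltW.
Qed.

Lemma expectation_bounded_fin (h : R -> R) (M : R) : continuous h ->
  (forall x, `|h x| <= M) -> ('E_P[h \o Y] = (fine 'E_P[h \o Y])%:E)%E.
Proof.
move=> hc hM; rewrite fineK // unlock integrable_fin_num //.
exact: (integrable_bounded_comp hc hM).
Qed.

Lemma fine_expectation_dist (h1 h2 g : R -> R) (M : R) :
  continuous h1 -> continuous h2 -> continuous g ->
  (forall x, `|h1 x| <= M) -> (forall x, `|h2 x| <= M) -> (forall x, `|g x| <= M) ->
  (forall x, `|h1 x - h2 x| <= 2 * g x) ->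
  `|fine 'E_P[h1 \o Y]%E - fine 'E_P[h2 \o Y]%E| <= 2 * fine 'E_P[g \o Y]%E.
Proof.
move=> c1 c2 cg b1 b2 bg h12; rewrite unlock.
have i1 := integrable_bounded_comp c1 b1; have i2 := integrable_bounded_comp c2 b2.
have ig := integrable_bounded_comp cg bg.
rewrite -/(Rintegral P setT (h1 \o Y)) -/(Rintegral P setT (h2 \o Y)).
rewrite -/(Rintegral P setT (g \o Y)) -RintegralB // -RintegralZl //.
have i12 : P.-integrable setT (EFin \o (fun w => h1 (Y w) - h2 (Y w))).
  exact: (integrableB measurableT i1 i2).
apply: le_trans (le_normr_Rintegral measurableT i12) _.
apply: le_Rintegral => //.
- exact: (integrable_norm i12).
- exact: (@integrableZl _ _ _ P setT measurableT 2 _ ig).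
Qed.

(** Dominated convergence along [1 / k.+1], with dominating constant [1]: the truncated norm tends
    to [0] pointwise. No moment of [Y] is involved. *)
Lemma expectation_truncated_norm_small (e : R) : 0 < e ->
  exists2 del : R, 0 < del & fine 'E_P[truncated_norm del \o Y]%E < e.
Proof.
move=> e0.
pose F k w := (truncated_norm k.+1%:R^-1 (Y w))%:E.
have k0 k : (0 : R) < k.+1%:R^-1 by rewrite invr_gt0.
have tk k := @continuous_truncated_norm R k.+1%:R^-1.
have tb k x := truncated_norm_bounded x (ltW (k0 k)).
have mF k : measurable_fun setT (F k).
  by have /integrableP[] := integrable_bounded_comp (tk k) (tb k).
have [] := @dominated_convergence _ _ _ P setT measurableT F (cst 0%E) (cst 1%E) mF.
- exact: measurable_cst.
- apply: aeW => w _; apply: cvg_EFin; first by near=> k.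
  apply/cvgrPdist_le => a a0; exists (Num.truncn (`|Y w| / a)) => // k /= Nk.
  rewrite sub0r normrN ger0_norm ?truncated_norm_ge0 // ge_min; apply/orP; right.
  rewrite mulrC ler_pdivrMr // mulrC -ler_pdivrMr //; apply: ltW.
  by apply: lt_le_trans (truncnS_gt _) _; rewrite ler_nat.
- exact: (finite_measure_integrable_cst P 1 measurableT).
- by apply: aeW => w k _; rewrite lee_fin tb.
move=> _ _; rewrite integral_cst // mul0e => /fine_cvg /cvgrPdist_lt /(_ e e0).
move=> [k _ /(_ k (leqnn k))] /=; rewrite sub0r normrN => h.
exists k.+1%:R^-1 => //; rewrite unlock; exact: le_lt_trans (ler_norm _) h.
Unshelve. all: by end_near.
Qed.

End bounded_expectation.

(** * The limiting characteristic function as a locally uniform limit *)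

Section quicksort_limit.
Local Open Scope complex_scope.
Context (R : realType) (d : measure_display) (T : measurableType d).
Context (P : probability T R) (Y : {RV P >-> R}).
Context (hY : quicksort_limit Y).
Local Notation psi := (@centered_char_fun R).
Local Notation f := (char_fun Y).
Local Notation X n := (@quicksort_normalized R n).

Let continuous_cosZ (t : R) : continuous (fun x => cos (t * x)).
Proof.
by move=> x; apply: continuous_comp; [exact: mulrl_continuous|exact: continuous_cos].
Qed.

Let continuous_sinZ (t : R) : continuous (fun x => sin (t * x)).
Proof.
by move=> x; apply: continuous_comp; [exact: mulrl_continuous|exact: continuous_sin].
Qed.

Lemma quicksort_cvg_expectation (g : R -> R) (M : R) : continuous g ->
  (forall x, `|g x| <= M) -> forall e : R, 0 < e -> exists N, forall n, (N <= n)%N ->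
  `|fine 'E_P[g \o Y]%E - fine 'E_(@unif_perm R n)[g \o X n]%E| < e.
Proof.
move=> gc gM e e0; have := hY gc (ex_intro _ M gM).
rewrite (expectation_bounded_fin Y gc gM) => /fine_cvg /cvgrPdist_lt /(_ e e0).
by move=> [N _ HN]; exists N => n Nn; exact: HN.
Qed.

Lemma char_fun_at0 : f 0 = 1.
Proof.
rewrite /char_fun /complex_expectation /expi /=.
have -> : (fun w => cos (0 * Y w)) = cst 1 by apply/funext => w; rewrite mul0r cos0.
have -> : (fun w => sin (0 * Y w)) = cst 0 by apply/funext => w; rewrite mul0r sin0.
by rewrite !expectation_cst.
Qed.

Lemma centered_char_fun_cvg (t e : R) : 0 < e -> exists N, forall n, (N <= n)%N ->
  `|psi n (t / n%:R) - f t|C <= e.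
Proof.
move=> e0; have e2 : 0 < e / 2 by lra.
have [N1 H1] := quicksort_cvg_expectation (@continuous_cosZ t) (fun x => cos_max (t * x)) e2.
have [N2 H2] := quicksort_cvg_expectation (@continuous_sinZ t) (fun x => sin_max (t * x)) e2.
exists (N1 + N2).+1 => n Nn.
rewrite centered_char_fun_ReIm; last by rewrite (leq_trans _ Nn).
apply: le_trans (normc_le_ReIm _) _ => /=.
have /H1 h1 : (N1 <= n)%N by rewrite (leq_trans _ (ltnW Nn)) // leq_addr.
have /H2 h2 : (N2 <= n)%N by rewrite (leq_trans _ (ltnW Nn)) // leq_addl.
rewrite [leRHS](splitr e); apply: lerD; rewrite distrC; exact: ltW.
Qed.

(** The bound passes to the limit from [centered_char_fun_le1]. *)
Lemma char_fun_le1 (t : R) : `|f t|C <= 1.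
Proof.
apply/ler_addgt0Pr => e e0; have [N /(_ N (leqnn N)) h] := centered_char_fun_cvg t e0.
apply: le_trans (normcB_le _ (psi N (t / N%:R))) _.
by rewrite lerD ?centered_char_fun_le1 // normc_distC.
Qed.

Lemma char_fun_dist (del t s : R) : 0 < del -> `|t - s| <= del ->
  `|f t - f s|C <= 4 * fine 'E_P[truncated_norm del \o Y]%E.
Proof.
move=> d0 ts; apply: le_trans (normc_le_ReIm _) _.
have tb x := truncated_norm_bounded x (ltW d0).
have tc := @continuous_truncated_norm R del.
have h1 := fine_expectation_dist Y (@continuous_cosZ t) (@continuous_cosZ s) tc
  (fun x => cos_max _) (fun x => cos_max _) tb (fun x => cos_truncated_norm x ts).
have h2 := fine_expectation_dist Y (@continuous_sinZ t) (@continuous_sinZ s) tc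
  (fun x => sin_max _) (fun x => sin_max _) tb (fun x => sin_truncated_norm x ts).
rewrite (natrD R 2 2).
by rewrite mulrDl; exact: lerD h1 h2.
Qed.

(** The right-hand side converges as [n] grows, so this is an equicontinuity bound. The [4] is a [2]
    for each of the real and imaginary parts. *)
Lemma centered_char_fun_dist (n : nat) (del t s : R) : (0 < n)%N -> 0 < del ->
  `|t - s| <= del ->
  `|psi n (t / n%:R) - psi n (s / n%:R)|C <=
  4 * fine 'E_(@unif_perm R n)[truncated_norm del \o X n]%E.
Proof.
move=> n0 d0 ts; rewrite !centered_char_fun_ReIm //.
apply: le_trans (normc_le_ReIm _) _.
have tb x := truncated_norm_bounded x (ltW d0).
have tc := @continuous_truncated_norm R del.
have h1 := fine_expectation_dist (P := @unif_perm R n) (X n)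
  (@continuous_cosZ t) (@continuous_cosZ s) tc
  (fun x => cos_max _) (fun x => cos_max _) tb (fun x => cos_truncated_norm x ts).
have h2 := fine_expectation_dist (P := @unif_perm R n) (X n)
  (@continuous_sinZ t) (@continuous_sinZ s) tc
  (fun x => sin_max _) (fun x => sin_max _) tb (fun x => sin_truncated_norm x ts).
rewrite (natrD R 2 2).
by rewrite mulrDl; exact: lerD h1 h2.
Qed.

Lemma char_fun_unif (e : R) : 0 < e -> exists2 del : R, 0 < del &
  forall t s : R, `|t - s| <= del -> `|f t - f s|C <= e.
Proof.
move=> e0; have e4 : 0 < e / 4 by lra.
have [del d0 hd] := expectation_truncated_norm_small Y e4.
exists del => // t s ts; apply: le_trans (char_fun_dist d0 ts) _; lra.
Qed.

(** Pointwise convergence on a finite grid of mesh [del], together with a common modulus of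
    continuity, gives uniform convergence on [[0, B]]. *)
Lemma centered_char_fun_unif_cvg (B e : R) : 0 < e -> exists N,
  forall (n : nat) (s : R), (N <= n)%N -> 0 <= s -> s * n%:R <= B ->
  `|psi n s - f (s * n%:R)|C <= e.
Proof.
move=> e0; have e16 : 0 < e / 16 by lra.
have [del d0 hd] := expectation_truncated_norm_small Y e16.
have tb x := truncated_norm_bounded x (ltW d0).
have [N1 HN1] := quicksort_cvg_expectation (@continuous_truncated_norm R del) tb e16.
have grid K : exists N, forall i n, (i <= K)%N -> (N <= n)%N ->
    `|psi n ((i%:R * del) / n%:R) - f (i%:R * del)|C <= e / 16.
  elim: K => [|K [N HN]].
    have [N HN] := centered_char_fun_cvg (0%:R * del) e16.
    by exists N => i n; rewrite leqn0 => /eqP -> /HN.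
  have [N' HN'] := centered_char_fun_cvg (K.+1%:R * del) e16.
  exists (N + N')%N => i n; rewrite leq_eqVlt => /orP[/eqP ->|iK] Nn.
    by apply: HN'; rewrite (leq_trans _ Nn) // leq_addl.
  by apply: HN => //; rewrite (leq_trans _ Nn) // leq_addr.
have [N2 HN2] := grid (Num.truncn (B / del)).
exists (N1 + N2).+1 => n s Nn s0 sB.
have n0 : (0 < n)%N by rewrite (leq_trans _ Nn).
have N1n : (N1 <= n)%N by rewrite (leq_trans _ (ltnW Nn)) // leq_addr.
have N2n : (N2 <= n)%N by rewrite (leq_trans _ (ltnW Nn)) // leq_addl.
set u := s * n%:R; have su : s = u / n%:R by rewrite /u mulfK // pnatr_eq0 -lt0n.
have u0 : 0 <= u / del by rewrite divr_ge0 ?mulr_ge0 // ltW.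
set i := Num.truncn (u / del).
have iK : (i <= Num.truncn (B / del))%N.
  by apply: le_truncn; rewrite ler_pM2r ?invr_gt0.
have ui : `|u - i%:R * del| <= del.
  have /andP[iu ui] := truncn_itv u0.
  rewrite ler_pdivlMr // in iu; rewrite ltr_pdivrMr // -natr1 mulrDl mul1r in ui.
  by rewrite ger0_norm ?subr_ge0 //; rewrite -/i in ui; lra.
rewrite su.
have -> : psi n (u / n%:R) - f u =
  (psi n (u / n%:R) - psi n (i%:R * del / n%:R)) +
  ((psi n (i%:R * del / n%:R) - f (i%:R * del)) + (f (i%:R * del) - f u)).
  by ring.
apply: le_trans (normcD_le _ _) _.
have h1 := centered_char_fun_dist n0 d0 ui; have h2 := HN1 n N1n.
have h3 := normcD_le (psi n (i%:R * del / n%:R) - f (i%:R * del)) (f (i%:R * del) - f u).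
have h4 := HN2 _ _ iK N2n; have := char_fun_dist d0 ui; rewrite normc_distC => h5.
(* The error budget is [4 * (e / 8)] for [psi], [e / 16] at the grid point and [4 * (e / 16)] for
   [f]. *)
have h6 : fine 'E_(@unif_perm R n)[truncated_norm del \o X n]%E <= e / 8.
  by move: h2; rewrite ltr_norml => /andP[h2 _]; lra.
lra.
Qed.

(** [f (- t)] is the conjugate of [f t], cosine being even and sine odd; this carries the decay over
    to negative [t]. *)
Lemma char_funN (t : R) : `|f (- t)|C = `|f t|C.
Proof.
have -> : f (- t) = complex.Re (f t) +i* (- complex.Im (f t)).
  rewrite /char_fun /complex_expectation /expi /=; congr (_ +i* _).
    by congr (fine 'E_P[_]); apply/funext => w; rewrite mulNr cosN.
  have i1 := integrable_bounded_comp Y (@continuous_sinZ t) (fun x => sin_max _).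
  rewrite unlock -fineN -integralN /=; last by rewrite integrable_add_def.
  by congr fine; apply: eq_integral => w _; rewrite mulNr sinN.
by case: (f t) => a b /=; rewrite sqrrN.
Qed.

End quicksort_limit.

Theorem theorem1 (R : realType) (d : measure_display) (T : measurableType d)
    (P : probability T R) (Y : {RV P >-> R}) (hY : quicksort_limit Y) :
  exists eta : R, 0 < eta /\
    bigO_abs_infty (char_fun Y) (fun t => expR (- eta * `|t|)).
Proof.
have [eta eta0 H] := f_exp_decay (char_fun_at0 Y) (char_fun_le1 hY)
  (char_fun_unif Y) (centered_char_fun_unif_cvg hY).
exists eta; split=> //; exists 1, 1 => t t1.
rewrite mul1r (ger0_norm (expR_ge0 _)); apply: le_trans (H _ t1).
by case: (ger0P t) => _ //; rewrite char_funN.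
Qed.
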